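(* Let $\mathcal{F}\subseteq\{0,1\}^n$, $T=\operatorname{conv}(\mathcal{F})$, and let $f=\sum_{i=1}^k a_i\Psi_i$ (as a function $\mathcal{F}\to\mathbb{R}$) with $\Psi_i\colon\{0,1\}^n\to\{0,1\}$ and $a_i\in\mathbb{R}$ for $i\in\{1,\ldots,k\}$. Then for all $x\in T$, \[ \operatorname{vex}[f](x)=\min\Big\{\sum_{i=1}^k a_i\,\Omega(S_1,\ldots,S_n,\Psi_i)\ \Big|\ (S_1,\ldots,S_n)\in Z(x)\Big\}, \] \[ \operatorname{cav}[f](x)=\max\Big\{\sum_{i=1}^k a_i\,\Omega(S_1,\ldots,S_n,\Psi_i)\ \Big|\ (S_1,\ldots,S_n)\in Z(x)\Big\}. \] In particular, for a polytope $P\subseteq\mathbb{R}^{n+k}$ with $\pi[f](P)\subseteq X(f)$, we have $\pi[f](P)=X(f)$ if and only if for every $x\in T$ there are sets $(S_1,\ldots,S_n)\in Z(x)$ and $(S'_1,\ldots,S'_n)\in Z(x)$ with \[ \sum_{i=1}^k a_i\,\Omega(S_1,\ldots,S_n,\Psi_i)=\operatorname{LB}_P[f](x),\qquad \sum_{i=1}^k a_i\,\Omega(S'_1,\ldots,S'_n,\Psi_i)=\operatorname{UB}_P[f](x). \]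
   Context: Let $U=[0,1)$, let $\mathcal{L}$ be the set of all unions of finitely many (possibly zero) half-open subintervals $[a,b)$ of $U$, and let $\mu$ be Lebesgue measure restricted to $\mathcal{L}$. For $t\in U$ and $S\in\mathcal{L}$ let $\phi(t,S)=1$ if $t\in S$ and $0$ otherwise, and let $\varphi(t,S_1,\ldots,S_n)=(\phi(t,S_1),\ldots,\phi(t,S_n))\in\{0,1\}^n$. For $x\in[0,1]^n$, $Z(x)$ is the set of all $(S_1,\ldots,S_n)\in\mathcal{L}^n$ with $\mu(S_i)=x_i$ for all $i\in\{1,\ldots,n\}$ and $\varphi(t,S_1,\ldots,S_n)\in\mathcal{F}$ for all $t\in U$. For a real-valued function $\Psi$ on $\mathcal{F}$ and $(S_1,\ldots,S_n)\in Z(x)$, $\Omega(S_1,\ldots,S_n,\Psi)=\mu(\{t\in U\mid \Psi(\varphi(t,S_1,\ldots,S_n))=1\})$. The convex hull of the graph of $f$ is $X(f)=\operatorname{conv}\{(x,z)\in T\times\mathbb{R}\mid z=f(x)\}$, where $x$ ranges over the domain $\mathcal{F}$ of $f$. The convex and concave envelopes of $f$ over $T$ are given, for $x\in T$, by $\operatorname{vex}[f](x)=\min\{z\in\mathbb{R}\mid (x,z)\in X(f)\}$ and $\operatorname{cav}[f](x)=\max\{z\in\mathbb{R}\mid (x,z)\in X(f)\}$. Points of $\mathbb{R}^{n+k}$ are written $(x,y)$ with $x\in\mathbb{R}^n$, $y\in\mathbb{R}^k$, where $y_i$ represents the value $\Psi_i(x_1,\ldots,x_n)$. Let $\pi[f](x,y)=(x,\sum_{i=1}^k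 a_iy_i)\in\mathbb{R}^{n+1}$ and $\pi[f](P)=\{\pi[f](x,y)\mid (x,y)\in P\}$. The functions $\operatorname{LB}_P[f],\operatorname{UB}_P[f]\colon T\to\mathbb{R}$ are $\operatorname{LB}_P[f](x)=\min\{\sum_{i=1}^k a_iy_i\mid (x,y)\in P\}$ and $\operatorname{UB}_P[f](x)=\max\{\sum_{i=1}^k a_iy_i\mid (x,y)\in P\}$. *)

(* Defs.v *)
From mathcomp Require Import all_boot all_order all_algebra.
From mathcomp Require Import all_classical all_reals all_analysis.

Set Implicit Arguments.
Unset Strict Implicit.
Unset Printing Implicit Defensive.

Import Order.TTheory GRing.Theory Num.Theory.

Local Open Scope classical_set_scope.
Local Open Scope ring_scope.

Definition is_min (R : realType) (A : set R) (m : R) : Prop :=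
  A m /\ lbound A m.

Definition is_max (R : realType) (A : set R) (m : R) : Prop :=
  A m /\ ubound A m.

Definition conv_hull (R : realType) (V : lmodType R) (A : set V) : set V :=
  smallest (@convex_set R V) A.

Definition polytope (R : realType) (V : lmodType R) (P : set V) : Prop :=
  exists s : seq V, P = conv_hull [set` s].

(* {0,1}^n, with true for 1 and false for 0. *)
Notation cube n := {ffun 'I_n -> bool}.

Definition vertex (R : realType) (n : nat) (v : cube n) : 'rV[R]_n :=
  \row_i (v i)%:R.

Definition T_of (R : realType) (n : nat) (F : {set cube n}) : set 'rV[R]_n :=
  conv_hull [set vertex R v | v in [set` F]].

(* Only the values of [f] on [F] are used: these definitions do not depend on
   how a function on [F] is extended to the cube. *)
Definition graph_hull (R : realType) (n : nat) (F : {set cube n})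
    (f : cube n -> R) : set ('rV[R]_n * R^o) :=
  conv_hull [set (vertex R v, f v : R^o) | v in [set` F]].

Definition is_vex (R : realType) (n : nat) (F : {set cube n})
    (f : cube n -> R) (x : 'rV[R]_n) (v : R) : Prop :=
  is_min [set z : R | graph_hull F f (x, z)] v.

Definition is_cav (R : realType) (n : nat) (F : {set cube n})
    (f : cube n -> R) (x : 'rV[R]_n) (v : R) : Prop :=
  is_max [set z : R | graph_hull F f (x, z)] v.

Definition U_itv (R : realType) : set R := `[0, 1[%classic.

(* Finite (possibly empty) unions of half-open subintervals of [0, 1[. *)
Definition Lsets (R : realType) : set (set R) :=
  [set S : set R | exists s : seq (R * R),
     (forall p, p \in s -> `[p.1, p.2[%classic `<=` @U_itv R) /\
     S = \bigcup_(p in [set` s]) `[p.1, p.2[%classic].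

(* [fine] loses nothing here: the sets in [Lsets] have finite measure. *)
Definition leb (R : realType) (S : set R) : R := fine (lebesgue_measure S).

Definition incidence (R : realType) (n : nat) (t : R) (S : 'I_n -> set R) :
    cube n :=
  [ffun i => t \in S i].

Definition Zsets (R : realType) (n : nat) (F : {set cube n})
    (x : 'rV[R]_n) : set ('I_n -> set R) :=
  [set S | [/\ forall i, Lsets (S i),
               forall i, leb (S i) = x ord0 i
             & forall t, U_itv t -> incidence t S \in F]].

Definition Omega (R : realType) (n : nat) (S : 'I_n -> set R)
    (Psi : cube n -> R) : R :=
  leb [set t | U_itv t /\ Psi (incidence t S) = 1].

Definition Omega_sum (R : realType) (n k : nat) (a : 'I_k -> R)
    (Psi : 'I_k -> cube n -> bool) (S : 'I_n -> set R) : R :=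
  \sum_(i < k) a i * Omega S (fun v => (Psi i v)%:R).

(* A point (x, y) of R^(n+k) is [row_mx x y], so that [lsubmx] and [rsubmx]
   recover x and y. *)
Definition obj_proj (R : realType) (n k : nat) (a : 'I_k -> R)
    (w : 'rV[R]_(n + k)) : 'rV[R]_n * R^o :=
  (lsubmx w, \sum_(i < k) a i * rsubmx w ord0 i).

(* [is_LB a P x v] also says that P has a point above x. *)
Definition is_LB (R : realType) (n k : nat) (a : 'I_k -> R)
    (P : set 'rV[R]_(n + k)) (x : 'rV[R]_n) (v : R) : Prop :=
  is_min [set \sum_(i < k) a i * y ord0 i
         | y in [set y : 'rV[R]_k | P (row_mx x y)]] v.

Definition is_UB (R : realType) (n k : nat) (a : 'I_k -> R)
    (P : set 'rV[R]_(n + k)) (x : 'rV[R]_n) (v : R) : Prop :=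
  is_max [set \sum_(i < k) a i * y ord0 i
         | y in [set y : 'rV[R]_k | P (row_mx x y)]] v.

(* Main.v *)
Require Import Defs.
From mathcomp Require Import all_boot all_order all_algebra.
From mathcomp Require Import all_classical all_reals all_analysis.
From mathcomp Require Import lra.

Set Implicit Arguments.
Unset Strict Implicit.
Unset Printing Implicit Defensive.

Import Order.TTheory GRing.Theory Num.Theory.
Import numFieldNormedType.Exports.

Local Open Scope classical_set_scope.
Local Open Scope ring_scope.

(** Both sides of the first claim describe the same set of probability weights
    on the vertices in F.

    A point (x, z) lies in the convex hull of the graph of f exactly when some
    weights w on F satisfy x = sum_v w v v and z = sum_v w v f(v)
    ([graph_hull_weights]).  A tuple S in Z(x) cuts [0, 1) into the cells on
    which the incidence vector is constant, and the lengths of these cells are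
    such weights for x ([Zsets_weights]); as f is a combination of the
    indicators Psi_i, finite additivity of Lebesgue measure turns the objective
    value of S into sum_v w v f(v) ([Omega_sum_cells]).  Conversely, laying
    intervals of lengths w v side by side in [0, 1) and letting S_i be the union
    of those with v i = 1 gives a tuple whose cells have the prescribed lengths
    ([exists_sets_with_cells]).  Hence the objective values over Z(x) are
    exactly the fiber of the hull above x ([Omega_sum_image]).  That fiber has a
    least and a greatest element because the weights representing x form a
    compact set on which the objective is continuous ([ex_vex_cav]).

    For the second claim, if pi(P) is the hull X(f) then LB and UB are the
    envelopes, which are attained by the first claim.  In the other direction
    only the vertices x = v with v in F matter: LB at v is then the objective of
    a point of P above v, and the fiber of X(f) above a vertex of the cube is
    the single value f(v) ([graph_hull_vertex]), so pi(P) contains (v, f(v)).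
    Being convex, pi(P) contains X(f). *)

(** * Convex hulls of finite families *)

Lemma convex_setP (R : realType) (V : lmodType R) (A : set V) :
  @convex_set R V A <->
  forall (x y : V) (t : R), 0 <= t -> t <= 1 -> A x -> A y ->
    A (t *: x + (1 - t) *: y).
Proof.
split=> [cA x y t t0 t1 Ax Ay|cA x y t].
  by have := cA x y (Itv01 t0 t1); rewrite !inE; apply.
by rewrite !inE; apply: cA.
Qed.

Lemma convex_set_conv_hull (R : realType) (V : lmodType R) (A : set V) :
  @convex_set R V (conv_hull A).
Proof.
apply/convex_setP => x y t t0 t1 hx hy M [cM AM].
by move/convex_setP: (cM); apply=> //; [apply: hx|apply: hy].
Qed.

Definition convex_weights (R : realType) (I : finType) (A : {set I})
    (w : I -> R) : Prop :=
  [/\ forall i, 0 <= w i, forall i, i \notin A -> w i = 0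
    & \sum_i w i = 1].

(** The sum on the right is a factor of y, rather than a normalization on the
    left, so that partial sums of weight 0 need no separate statement and the
    induction on s goes through. *)
Lemma convex_set_sum (R : realType) (V : lmodType R) (M : set V)
    (I : eqType) (g : I -> V) (w : I -> R) (s : seq I) :
  @convex_set R V M -> M !=set0 -> (forall i, 0 <= w i) ->
  (forall i, i \in s -> M (g i)) ->
  exists2 y, M y & \sum_(i <- s) w i *: g i = (\sum_(i <- s) w i) *: y.
Proof.
move=> /convex_setP cM [y0 My0] w0; elim: s => [|i s IH] Ms.
  by exists y0; rewrite // !big_nil scale0r.
have [|y My e] := IH; first by move=> j js; apply: Ms; rewrite inE js orbT.
rewrite !big_cons e; set c := \sum_(j <- s) w j.
have c0 : 0 <= c by apply: sumr_ge0.
have [wc0|wc0] := eqVneq (w i + c) 0.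
  move/eqP: (wc0); rewrite paddr_eq0// => /andP[/eqP -> /eqP ->].
  by exists y0; rewrite // !scale0r !addr0 scale0r.
have wc : 0 < w i + c by rewrite lt_neqAle eq_sym wc0 addr_ge0.
(* Split off the i-th term with its share of the total weight so far. *)
exists ((w i / (w i + c)) *: g i + (1 - w i / (w i + c)) *: y).
  apply: cM => //; last by apply: Ms; rewrite mem_head.
    by rewrite divr_ge0// ltW.
  by rewrite ler_pdivrMr// mul1r lerDl.
rewrite scalerDr !scalerA mulrBr mulr1 [_ * (_ / _)]mulrC divfK//.
by rewrite [w i + c]addrC addrK.
Qed.

(** The weighted means form a convex set containing the family, and every convex
    set containing the family contains them. *)
Lemma conv_hull_weights (R : realType) (V : lmodType R) (I : finType)
    (A : {set I}) (g : I -> V) (x : V) :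
  conv_hull [set g i | i in [set` A]] x <->
  exists2 w : I -> R, convex_weights A w & x = \sum_i w i *: g i.
Proof.
split=> [hx|[w [w0 wA w1] ->] M [cM AM]]; last first.
  have sumA (W : zmodType) (h : I -> W) : (forall i, i \notin A -> h i = 0) ->
      \sum_i h i = \sum_(i <- enum A) h i.
    move=> h0; rewrite big_enum/= [RHS]big_mkcond/=; apply: eq_bigr => i _.
    by case: ifPn => // /h0.
  have M0 : M !=set0.
    have [i iA] : exists i, i \in A.
      apply/existsP; apply: contraT; rewrite negb_exists => /forallP A0.
      move: w1; rewrite big1; last by move=> i _; apply: wA.
      by move/eqP; rewrite eq_sym oner_eq0.
    by exists (g i); apply: AM; exists i.
  have [|y My] := @convex_set_sum R V M I g w (enum A) cM M0 w0.
    by move=> i; rewrite mem_enum => iA; apply: AM; exists i.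
  rewrite -!sumA//; last by move=> i /wA ->; rewrite scale0r.
  by rewrite w1 scale1r => ->.
apply: (hx [set y | exists2 w : I -> R,
  convex_weights A w & y = \sum_i w i *: g i]); split; last first.
  move=> _ [i /= iA <-]; exists (fun j => (j == i)%:R); last first.
    rewrite (bigD1 i)//= eqxx scale1r big1 ?addr0// => j /negPf ->.
    by rewrite scale0r.
  split=> //.
    by move=> j; apply: contraNeq; rewrite pnatr_eq0 eqb0 negbK => /eqP ->.
  by rewrite (bigD1 i)//= eqxx big1 ?addr0// => j /negPf ->.
apply/convex_setP => _ _ t t0 t1 [w [w0 wA w1] ->] [u [u0 uA u1] ->].
have t1' : 0 <= 1 - t by rewrite subr_ge0.
exists (fun i => t * w i + (1 - t) * u i).
  split.
  - by move=> i; rewrite addr_ge0// mulr_ge0.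
  - by move=> i iA; rewrite wA// uA// !mulr0 addr0.
  - by rewrite big_split/= -!mulr_sumr w1 u1 !mulr1 addrC subrK.
rewrite !scaler_sumr -big_split/=; apply: eq_bigr => i _.
by rewrite !scalerA scalerDl.
Qed.

Lemma graph_hull_weights (R : realType) (n : nat) (F : {set cube n})
    (f : cube n -> R) (x : 'rV[R]_n) (z : R) :
  graph_hull F f (x, z) <->
  exists w : cube n -> R, [/\ convex_weights F w,
    x = \sum_v w v *: vertex R v & z = \sum_v w v * f v].
Proof.
have sumE (w : cube n -> R) :
    \sum_v w v *: ((vertex R v, f v) : 'rV[R]_n * R^o) =
    (\sum_v w v *: vertex R v, \sum_v w v * f v).
  apply: (big_ind3 (fun p a b => p = (a, b)
      :> ('rV[R]_n * R^o)%type)) => //.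
  by move=> ? ? ? ? ? ? -> ->.
rewrite /graph_hull; split=> [/conv_hull_weights[w hw]|[w [hw -> ->]]].
  by rewrite sumE => -[-> ->]; exists w.
by apply/conv_hull_weights; exists w => //; rewrite sumE.
Qed.

Lemma T_of_graph_hull (R : realType) (n : nat) (F : {set cube n})
    (f : cube n -> R) (x : 'rV[R]_n) :
  T_of F x <-> exists z, graph_hull F f (x, z).
Proof.
split=> [/conv_hull_weights[w hw xw]|[z /graph_hull_weights[w [hw xw _]]]].
  by exists (\sum_v w v * f v); apply/graph_hull_weights; exists w.
by apply/conv_hull_weights; exists w.
Qed.

(** Vertices of the cube are extreme points: if v is a mean of 0/1 vectors, the
    weight of those that differ from v in coordinate i is 0 for every i, since
    v i is already the extreme value 0 or 1. *)
Lemma graph_hull_vertex (R : realType) (n : nat) (F : {set cube n})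
    (f : cube n -> R) (v : cube n) (z : R) :
  graph_hull F f (vertex R v, z) -> z = f v.
Proof.
move=> /graph_hull_weights[w [[w0 wF w1] vw ->]].
have wz u : u != v -> w u = 0.
  move=> uv; have [i uvi] : exists i, u i != v i.
    apply/existsP; apply: contraNT uv; rewrite negb_exists => /forallP e.
    by apply/eqP/ffunP => i; have := e i; rewrite negbK => /eqP.
  have h : \sum_u w u * (u i != v i)%:R = 0.
    have vi : (v i)%:R = \sum_u w u * (u i)%:R :> R.
      move/(congr1 (fun M : 'rV[R]_n => M ord0 i)): vw.
      rewrite mxE summxE => ->; apply: eq_bigr => j _; by rewrite !mxE.
    case: (v i) vi => vi.
      transitivity (\sum_u w u - \sum_u w u * (u i)%:R).
        rewrite -sumrB; apply: eq_bigr => j _.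
        by case: (j i); rewrite /= ?mulr0 ?mulr1 ?subrr ?subr0.
      by rewrite w1 -vi subrr.
    by apply: etrans (esym vi); apply: eq_bigr => j _; case: (j i).
  have := psumr_eq0P _ h; move/(_ (fun j _ => mulr_ge0 (w0 j) (ler0n _ _))).
  by move/(_ u isT); rewrite uvi mulr1.
rewrite (bigD1 v)//= big1 ?addr0; last by move=> u /wz ->; rewrite mul0r.
move: w1; rewrite (bigD1 v)//= big1 ?addr0; last by move=> u /wz ->.
by move=> ->; rewrite mul1r.
Qed.

(** * Compactness of the weights and existence of the envelopes *)

Lemma continuous_sumMr (R : realType) (T : topologicalType) (I : finType)
    (p : I -> T -> R) (h : I -> R) :
  (forall i, continuous (p i)) -> continuous (fun t => \sum_i p i t * h i).
Proof.
move=> pc; apply: continuous_big => [|i _ t]; first exact: add_continuous.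
by apply: cvgM; [exact: pc|exact: cvg_cst].
Qed.

(** In the product topology on functions cube -> R, the weights are a closed
    part of the compact product of copies of [0, 1]. *)
Lemma compact_convex_weights (R : realType) (n : nat) (F : {set cube n})
    (x : 'rV[R]_n) :
  compact ([set w | convex_weights F w /\ x = \sum_v w v *: vertex R v]
    : set (prod_topology (fun _ : cube n => R))).
Proof.
pose W := prod_topology (fun _ : cube n => R).
have cpt := @tychonoff _ (fun _ : cube n => R) _
  (fun _ => @segment_compact R 0 1).
have projc (v : cube n) : continuous (fun w : W => w v).
  exact: (@proj_continuous _ (fun _ : cube n => R) v).
have sumc (h : cube n -> R) : continuous (fun w : W => \sum_v w v * h v).
  exact: (@continuous_sumMr R W _ (fun v w => w v)).
have closed_eqc (h : W -> R) (c : R) : continuous h -> closed [set w | h w = c].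
  move=> /continuous_closedP hc; exact: (hc [set y | y = c] (@closed_eq _ c)).
apply: (subclosed_compact _ cpt); last first.
  move=> w [[w0 wF w1] _] v /=; rewrite in_itv/= w0/= -w1.
  by rewrite (bigD1 v)//= lerDl sumr_ge0.
rewrite (_ : mkset _ =
   \bigcap_v (fun w : W => w v) @^-1` [set r | 0 <= r]
   `&` \bigcap_(v in [set v | v \notin F]) [set w : W | w v = 0]
   `&` [set w : W | \sum_v w v * 1 = 1]
   `&` \bigcap_(i : 'I_n) [set w : W | \sum_v w v * (v i)%:R = x ord0 i]).
  repeat apply: closedI.
  - apply: closed_bigI => v _; move/continuous_closedP: (projc v); apply.
    exact: closed_ge.
  - by apply: closed_bigI => v _; apply: closed_eqc.
  - by apply: closed_eqc.
  - by apply: closed_bigI => i _; apply: closed_eqc.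
have vE (w : cube n -> R) i :
    (\sum_v w v *: vertex R v) ord0 i = \sum_v w v * (v i)%:R.
  by rewrite summxE; apply: eq_bigr => v _; rewrite !mxE.
apply/seteqP; split=> [w [[w0 wF w1] xw]|w [[[w0 wF] w1] xw]].
  split; [split; [split|]|] => /=.
  - by move=> v _; apply: w0.
  - by move=> v /=; apply: wF.
  - by rewrite -[RHS]w1; apply: eq_bigr => v _; rewrite mulr1.
  - by move=> i _ /=; rewrite xw vE.
split; last by apply/rowP => i; rewrite vE -(xw i).
split; [by move=> v; apply: (w0 v)|exact: wF|].
by rewrite -[RHS]w1; apply: eq_bigr => v _; rewrite mulr1.
Qed.

Lemma ex_vex_cav (R : realType) (n : nat) (F : {set cube n})
    (f : cube n -> R) (x : 'rV[R]_n) :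
  T_of F x -> (exists m, is_vex F f x m) /\ (exists M, is_cav F f x M).
Proof.
move=> /conv_hull_weights[w0 hw0 xw0].
pose W := prod_topology (fun _ : cube n => R).
have sumc : continuous (fun w : W => \sum_v w v * f v).
  apply: (@continuous_sumMr R W _ (fun v w => w v)) => v.
  exact: (@proj_continuous _ (fun _ : cube n => R) v).
pose K : set W := [set w | convex_weights F w /\ x = \sum_v w v *: vertex R v].
have K0 : K !=set0 by exists w0.
have Kc : compact K := @compact_convex_weights R n F x.
have Kf : {within K, continuous (fun w : W => \sum_v w v * f v)}.
  exact: continuous_subspaceT.
split.
- have [w /set_mem[hw xw] wmin] := compact_EVT_min K0 Kc Kf.
  exists (\sum_v w v * f v); split; first by apply/graph_hull_weights; exists w.
  move=> z /graph_hull_weights[u [hu xu ->]]; apply: wmin; exact: mem_set.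
- have [w /set_mem[hw xw] wmax] := compact_EVT_max K0 Kc Kf.
  exists (\sum_v w v * f v); split; first by apply/graph_hull_weights; exists w.
  move=> z /graph_hull_weights[u [hu xu ->]]; apply: wmax; exact: mem_set.
Qed.

(** * Set tuples and their cells *)

Definition cell (R : realType) (n : nat) (S : 'I_n -> set R) (v : cube n) :
  set R := [set t | U_itv t /\ incidence t S = v].

Lemma Lsets_measurable (R : realType) (S : set R) : Lsets S -> measurable S.
Proof.
move=> [s [_ ->]]; apply: fin_bigcup_measurable => [|p _].
  exact: finite_seq.
exact: measurable_itv.
Qed.

Lemma measurable_cell (R : realType) (n : nat) (S : 'I_n -> set R)
    (v : cube n) :
  (forall i, measurable (S i)) -> measurable (cell S v).
Proof.
move=> mS; rewrite (_ : cell S v =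
  @U_itv R `&` \bigcap_(i in [set: 'I_n]) (if v i then S i else ~` S i)).
  apply: measurableI; first exact: measurable_itv.
  apply: fin_bigcap_measurable => // i _; case: (v i) => //.
  exact: measurableC.
apply/seteqP; split=> t [Ut tv]; split=> //.
  move=> i _; rewrite -tv ffunE; case: ifPn => [|]; first by move/set_mem.
  by move=> h /mem_set; apply/negP.
apply/ffunP => i; rewrite ffunE; move: (tv i I); case: (v i) => h.
  exact: mem_set.
by apply/negP => /set_mem.
Qed.

Lemma leb_U (R : realType) : leb (@U_itv R) = 1.
Proof.
rewrite /leb /U_itv lebesgue_measure_itv/= lte01.
by rewrite oppr0 adde0.
Qed.

Lemma leb_ge0 (R : realType) (S : set R) : 0 <= leb S.
Proof. exact/fine_ge0/measure_ge0. Qed.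

(** Any set described by the incidence vector is a disjoint union of cells, so
    its length, and with it every x_i and every Omega, is linear in the lengths
    of the cells. *)
Lemma leb_incidence (R : realType) (n : nat) (S : 'I_n -> set R)
    (Q : pred (cube n)) :
  (forall i, measurable (S i)) ->
  leb [set t | U_itv t /\ Q (incidence t S)] =
  \sum_v leb (cell S v) * (Q v)%:R.
Proof.
move=> mS; have mc v := @measurable_cell R n S v mS.
have fc v : lebesgue_measure (cell S v) \is a fin_num.
  rewrite ge0_fin_numE//.
  apply: (@le_lt_trans _ _ (lebesgue_measure (@U_itv R))).
    apply: le_measure => [||t []//]; apply/mem_set; first exact: mc.
    exact: measurable_itv.
  by rewrite lebesgue_measure_itv/= lte01 oppr0 adde0 ltry.
have -> : [set t | U_itv t /\ Q (incidence t S)] =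
    \bigcup_(v in [set` enum Q]) cell S v.
  apply/seteqP; split=> [t [Ut Qt]|t [v /= Qv [Ut e]]].
    by exists (incidence t S); rewrite //= mem_enum.
  by split=> //; rewrite e; move: Qv; rewrite mem_enum.
rewrite /leb measure_fin_bigcup; first last.
- by move=> v _; exact: mc.
- by move=> u v _ _ [t [[_ <-] [_ <-]]].
- exact: finite_seq.
rewrite -fsbig_seq ?enum_uniq// big_enum/= -sum_fine//.
rewrite big_mkcond/=; apply: eq_bigr => v _.
by rewrite unfold_in; case: (Q v); rewrite ?mulr1 ?mulr0.
Qed.

Lemma leb_Zset (R : realType) (n : nat) (S : 'I_n -> set R) (i : 'I_n) :
  (forall i, Lsets (S i)) ->
  leb (S i) = \sum_v leb (cell S v) * (v i)%:R.
Proof.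
move=> LS; rewrite -leb_incidence => [|j]; last exact: Lsets_measurable.
congr leb; apply/seteqP; split=> [t St|t [Ut]]; rewrite /= ffunE.
  split; last exact: mem_set.
  have [s [sU e]] := LS i; move: St; rewrite e => -[p ps]; exact: sU.
by move/set_mem.
Qed.

(** Exchange the sums over i and over v: on F, f is the combination of the Psi_i,
    and the cells of the other v have length 0. *)
Lemma Omega_sum_cells (R : realType) (n k : nat) (F : {set cube n})
    (a : 'I_k -> R) (Psi : 'I_k -> cube n -> bool) (f : cube n -> R)
    (S : 'I_n -> set R) :
  (forall v, v \in F -> f v = \sum_(i < k) a i * (Psi i v)%:R) ->
  (forall i, measurable (S i)) ->
  (forall v, v \notin F -> leb (cell S v) = 0) ->
  Omega_sum a Psi S = \sum_v leb (cell S v) * f v.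
Proof.
move=> hf mS cF; rewrite /Omega_sum.
transitivity (\sum_(i < k) \sum_v a i * (leb (cell S v) * (Psi i v)%:R)).
  apply: eq_bigr => i _; rewrite -mulr_sumr -leb_incidence//; congr (_ * leb _).
  apply/seteqP; split=> t [Ut h]; split=> //; move: h; case: (Psi i _) => //=.
  by move/eqP; rewrite eq_sym oner_eq0.
rewrite exchange_big/=; apply: eq_bigr => v _.
have [vF|/cF ->] := boolP (v \in F); last first.
  by rewrite mul0r big1// => i _; rewrite mul0r mulr0.
by rewrite hf// mulr_sumr; apply: eq_bigr => i _; rewrite mulrCA.
Qed.

Lemma Zsets_weights (R : realType) (n : nat) (F : {set cube n})
    (x : 'rV[R]_n) (S : 'I_n -> set R) :
  Zsets F x S ->
  convex_weights F (fun v => leb (cell S v)) /\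
  x = \sum_v leb (cell S v) *: vertex R v.
Proof.
move=> [LS Sx SF]; split; last first.
  apply/rowP => i; rewrite summxE -Sx leb_Zset//; apply: eq_bigr => v _.
  by rewrite !mxE.
split=> [v|v vF|]; first exact: leb_ge0.
  rewrite (_ : cell S v = set0) ?/leb ?measure0//.
  by apply/seteqP; split=> // t [Ut e]; move: vF; rewrite -e SF.
rewrite -leb_U (_ : @U_itv R = [set t | U_itv t /\ predT (incidence t S)]).
  rewrite leb_incidence; last by move=> i; exact: Lsets_measurable.
  by apply: eq_bigr => v _; rewrite mulr1.
by apply/seteqP; split=> t //= [].
Qed.

(** * Sets with prescribed cells *)

Section Blocks.
Context (R : realType) (n : nat) (w : cube n -> R).
Context (w0 : forall v, 0 <= w v) (w1 : \sum_v w v = 1).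

Let c (j : nat) : R := \sum_(u | (enum_rank u < j)%N) w u.

Let block (v : cube n) : set R :=
  `[c (enum_rank v), c (enum_rank v).+1[%classic.

Let c_mono i j : (i <= j)%N -> c i <= c j.
Proof.
move=> ij; rewrite /c big_mkcond [leRHS]big_mkcond/=; apply: ler_sum => u _.
by case: ifPn => [ui|_]; [rewrite (leq_trans ui ij)|case: ifP].
Qed.

Let cS v : c (enum_rank v).+1 = c (enum_rank v) + w v.
Proof.
rewrite /c (bigD1 v)/= ?ltnS// addrC; congr (_ + _); apply: eq_bigl => u.
rewrite ltnS leq_eqVlt -(inj_eq enum_rank_inj) -val_eqE/=.
by case: ltngtP.
Qed.

Let c_card : c #|cube n| = 1.
Proof. by rewrite -w1; apply: eq_bigl => u; rewrite ltn_ord. Qed.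

Let block_sub v : block v `<=` @U_itv R.
Proof.
move=> t; rewrite /block /U_itv /= !in_itv/= => /andP[ct tc]; apply/andP; split.
  by apply: le_trans ct; apply: sumr_ge0.
by apply: lt_le_trans tc _; rewrite -c_card; apply: c_mono.
Qed.

Let block_cover t : U_itv t -> exists v, block v t.
Proof.
rewrite /U_itv /= in_itv/= => /andP[t0 t1].
(* The block of t ends at the first endpoint beyond t. *)
have ex : exists j, t < c j by exists #|cube n|; rewrite c_card.
case: (ex_minnP ex) => -[|j] tj minj.
  by move: tj; rewrite /c big_pred0// ltNge t0.
have jN : (j < #|cube n|)%N by apply: minj; rewrite c_card.
exists (enum_val (Ordinal jN)); rewrite /block /= in_itv/= enum_valK/= tj andbT.
by rewrite leNgt; apply/negP => /minj; rewrite ltnn.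
Qed.

Let block_disj u v t : block u t -> block v t -> u = v.
Proof.
rewrite /block /= !in_itv/= => /andP[ut tu] /andP[vt tv].
apply: enum_rank_inj; apply/val_inj => /=.
case: (ltngtP (enum_rank u) (enum_rank v)) => // h;
  have := c_mono h; rewrite leNgt => /negP[].
  exact: (le_lt_trans vt tu).
exact: (le_lt_trans ut tv).
Qed.

Let St (i : 'I_n) : set R :=
  \bigcup_(v in [set` [pred v : cube n | v i]]) block v.

Let incidence_block v t : block v t -> incidence t St = v.
Proof.
move=> vt; apply/ffunP => i; rewrite ffunE; apply/idP/idP.
  by move=> /set_mem[u ui ut]; rewrite -(block_disj ut vt).
by move=> vi; apply: mem_set; exists v.
Qed.

(** The last clause is what keeps the incidence vectors inside F: a vector of
    weight 0 has an empty block and is never met. *)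
Lemma exists_sets_with_cells : exists S : 'I_n -> set R,
  (forall i, Lsets (S i)) /\
  (forall v, leb (cell S v) = w v) /\
  (forall t, U_itv t -> w (incidence t S) != 0).
Proof.
exists St; split; [|split].
- move=> i; exists [seq (c (enum_rank v), c (enum_rank v).+1)
                   | v <- enum [pred v : cube n | v i]]; split.
    by move=> _ /mapP[v _ ->]; exact: block_sub.
  apply/seteqP; split=> [t [v /= vi vt]|t [_ /= /mapP[v vi ->] vt]].
    exists (c (enum_rank v), c (enum_rank v).+1) => //=.
    by apply/mapP; exists v; rewrite ?mem_enum.
  by exists v => //=; move: vi; rewrite mem_enum.
- move=> v; rewrite (_ : cell St v = block v).
    rewrite /leb /block lebesgue_measure_itv/= lte_fin cS.
    have [_|h] := ltP; first by rewrite /= addrAC subrr add0r.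
    by apply/eqP; rewrite eq_le w0; move: h; rewrite gerDl => ->.
  apply/seteqP; split=> [t [/block_cover[u ut]]|t vt].
    by rewrite (incidence_block ut) => <-.
  by split; [exact: block_sub vt|exact: incidence_block].
- move=> t /block_cover[v vt]; rewrite (incidence_block vt).
  apply/eqP => wv0; move: vt; rewrite /block /= in_itv/= cS wv0 addr0.
  by move=> /andP[h1 h2]; move: (le_lt_trans h1 h2); rewrite ltxx.
Qed.

End Blocks.

(** * Objective values and the fibers of the hull *)

(** The first claim for all objective values at once: Z(x) realizes the whole
    fiber of the hull above x, not only its two ends. *)
Lemma Omega_sum_image (R : realType) (n k : nat) (F : {set cube n})
    (a : 'I_k -> R) (Psi : 'I_k -> cube n -> bool) (f : cube n -> R)
    (x : 'rV[R]_n) :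
  (forall v, v \in F -> f v = \sum_(i < k) a i * (Psi i v)%:R) ->
  [set Omega_sum a Psi S | S in Zsets F x] = [set z | graph_hull F f (x, z)].
Proof.
move=> hf; apply/seteqP; split=> [_ [S ZS <-]|z /= /graph_hull_weights].
  have [hw xw] := Zsets_weights ZS; case: (hw) => _ wF _.
  apply/graph_hull_weights; exists (fun v => leb (cell S v)); split=> //.
  apply: Omega_sum_cells hf _ wF => i; apply: Lsets_measurable.
  by case: ZS.
move=> [w [[w0 wF w1] xw ->]].
have [S [LS [Sw S0]]] := exists_sets_with_cells w0 w1.
exists S; last first.
  rewrite (Omega_sum_cells hf) => [|i|v /wF <-//].
    by apply: eq_bigr => v _; rewrite Sw.
  exact: Lsets_measurable.
split=> // [i|t Ut]; last by apply: contraNT (S0 t Ut) => /wF ->.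
rewrite leb_Zset// xw summxE; apply: eq_bigr => v _.
by rewrite Sw !mxE.
Qed.

Lemma obj_proj_fiber (R : realType) (n k : nat) (a : 'I_k -> R)
    (P : set 'rV[R]_(n + k)) (x : 'rV[R]_n) :
  [set \sum_(i < k) a i * y ord0 i | y in [set y : 'rV[R]_k | P (row_mx x y)]]
  = [set z | (obj_proj a @` P) (x, z)].
Proof.
apply/seteqP; split=> [_ [y Py <-]|z [u Pu [<- <-]]].
  by exists (row_mx x y) => //; rewrite /obj_proj row_mxKl row_mxKr.
by exists (rsubmx u); rewrite //= hsubmxK.
Qed.

Lemma convex_obj_proj (R : realType) (n k : nat) (a : 'I_k -> R)
    (P : set 'rV[R]_(n + k)) :
  @convex_set R _ P ->
  @convex_set R ('rV[R]_n * R^o)%type (obj_proj a @` P).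
Proof.
move=> /convex_setP cP; apply/convex_setP => _ _ t t0 t1 [u Pu <-] [v Pv <-].
exists (t *: u + (1 - t) *: v); first exact: cP.
rewrite /obj_proj !linearD !linearZ; congr pair => /=.
rewrite /GRing.scale/= !mulr_sumr -big_split/=; apply: eq_bigr => i _.
by rewrite !mxE; lra.
Qed.
Theorem theorem6p1 (R : realType) (n k : nat) (F : {set cube n})
    (a : 'I_k -> R) (Psi : 'I_k -> cube n -> bool) (f : cube n -> R)
    (hf : forall v, v \in F -> f v = \sum_(i < k) a i * (Psi i v)%:R) :
  (forall x : 'rV[R]_n, T_of F x ->
     (exists m : R, is_vex F f x m /\
        is_min [set Omega_sum a Psi S | S in Zsets F x] m) /\
     (exists M : R, is_cav F f x M /\
        is_max [set Omega_sum a Psi S | S in Zsets F x] M)) /\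
  (forall P : set 'rV[R]_(n + k), polytope P ->
     obj_proj a @` P `<=` graph_hull F f ->
     (obj_proj a @` P = graph_hull F f <->
      forall x : 'rV[R]_n, T_of F x ->
        exists S S' : 'I_n -> set R,
          [/\ Zsets F x S, Zsets F x S',
              is_LB a P x (Omega_sum a Psi S)
            & is_UB a P x (Omega_sum a Psi S')])).
Proof.
split=> [x Tx|P [s Ps] PX].
  rewrite (Omega_sum_image x hf).
  have [[m hm] [M hM]] := @ex_vex_cav R n F f x Tx.
  by split; [exists m|exists M].
split=> [PX' x Tx|hx].
  have [[m hm] [M hM]] := @ex_vex_cav R n F f x Tx.
  have [S ZS Sm] : [set Omega_sum a Psi S | S in Zsets F x] m.
    by rewrite (Omega_sum_image x hf); case: hm.
  have [S' ZS' SM] : [set Omega_sum a Psi S | S in Zsets F x] M.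
    by rewrite (Omega_sum_image x hf); case: hM.
  exists S, S'; rewrite Sm SM; split=> //.
    by rewrite /is_LB obj_proj_fiber PX'.
  by rewrite /is_UB obj_proj_fiber PX'.
(* pi(P) is convex, so it suffices to reach the generators of the hull. *)
apply/seteqP; split=> //; apply: smallest_sub.
  by apply: convex_obj_proj; rewrite Ps; exact: convex_set_conv_hull.
move=> _ [v vF <-].
have Tv : T_of F (vertex R v) by apply: sub_gen_smallest; exists v.
have [S [_ [_ _ [+ _] _]]] := hx _ Tv.
rewrite obj_proj_fiber => Pv.
by rewrite -(graph_hull_vertex (PX _ Pv)).
Qed.
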